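(* Let $a(z)=\sum_{n\ge 0}a_nz^{n-1}$ and let $\varphi^+$ be the character defined in the context. For any plane tree $T$, $$\varphi^+(Y_T)=\sum_{F\ge T}a_F\,z^{-r(F)},$$ where the sum is over all plane forests $F$ greater than or equal to $T$ in the Tamari order on plane forests, $r(F)$ denotes the number of roots of $F$ (number of trees in $F$), and $a_F=a_{c_1}\cdots a_{c_n}$ if $c_1\cdots c_n$ is the reverse Polish code of $F$.
   Context: **Plane forests.** Plane (ordered) rooted trees and forests; $|F|$ is the number of vertices; $B_+(F)$ is the tree obtained by grafting the trees of $F$, in order, on a common root. Vertices of a forest are labelled $1,\dots,n$ in postorder. Write $i<_Fj$ if $i$ is a proper descendant of $j$. The Polish code of a forest is the word obtained by labelling each vertex by its number of children and reading the labels in prefix order; the reverse Polish code is the same word read backwards. (Since the $a_i$ commute, $a_F$ is simply the product over all vertices $v$ of $a_{c(v)}$, $c(v)$ being the number of children of $v$.) **$\mathcal{H}_{NCK}$.** The noncommutative Connes–Kreimer Hopf algebra $\mathcal{H}_{NCK}$ has basis $Y_F$ ($F$ plane forests), product = concatenation of forests, coproduct $\Delta Y_F=\sum_u Y_{F_{(1)}}\otimes Y_{F_{(2)}}$, the sum over words $u\in\{1,2\}^{|F|}$ with $i<_Fj\Rightarrow u_i\le u_j$, where $F_{(k)}$ is the restriction of $F$ to the vertices $i$ with $u_i=k$. **The character $\varphi^+$.** Let $a_0,a_1,\dots$ be commuting indeterminates, $K=\mathbb{C}[a_0,a_1,\dots]$, $\mathcal{A}=K((z))$ (Laurent series in $z$),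 $\mathcal{A}_+=z^{-1}K[z^{-1}]$, $\mathcal{A}_-=K[[z]]$, so $\mathcal{A}=\mathcal{A}_+\oplus\mathcal{A}_-$ and the projection $P_+$ on $\mathcal{A}_+$ takes the polar part. Let $\varphi$ be the character of $\mathcal{H}_{NCK}$ with $\varphi(Y_F)=a(z)^{|F|}$. Its Birkhoff factorisation is the unique pair of characters $\varphi^{\pm}:\mathcal{H}_{NCK}\to\mathcal{A}$ with $\varphi^+=\varphi^-\star\varphi$ (convolution: $(f\star g)(x)=\sum_{(x)}f(x_{(1)})g(x_{(2)})$) and $\varphi^\pm(Y_F)\in\mathcal{A}_\pm$ for all $F\ne\emptyset$. **Tamari order.** On plane trees with a fixed number of vertices, $T'$ covers $T$ if, for some vertex $x$ of $T$ that is neither the root nor a leaf, $T'$ is obtained by cutting off the leftmost subtree of $x$ and grafting it on the parent of $x$, immediately to the left of $x$; the Tamari order is the reflexive transitive closure. On forests, $F\le G$ iff $B_+(F)\le B_+(G)$. *)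

(* Defs.v *)
From HB Require Import structures.
From Stdlib Require Import Relations.Relation_Operators.
From mathcomp Require Import all_boot all_order all_algebra.
From mathcomp Require Import boolp classical_sets functions cardinality fsbigop.
From mathcomp Require Import reals complex finmap.
From mathcomp.multinomials Require Import monalg.

Set Implicit Arguments.
Unset Strict Implicit.
Unset Printing Implicit Defensive.

Import Order.TTheory GRing.Theory Num.Theory.

Local Open Scope ring_scope.

Inductive ptree : Type := Node of seq ptree.

Definition forest : Type := seq ptree.

Fixpoint tree_enc (t : ptree) : GenTree.tree void :=
  let: Node ts := t in GenTree.Node 0 (map tree_enc ts).

Fixpoint tree_dec (g : GenTree.tree void) : ptree :=
  match g with
  | GenTree.Leaf _ => Node [::]
  | GenTree.Node _ gs => Node (map tree_dec gs)
  end.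

Lemma tree_encK : cancel tree_enc tree_dec.
Proof.
rewrite /cancel; fix IH 1; case=> ts /=; congr Node; rewrite -map_comp.
by elim: ts => //= t ts ->; rewrite IH.
Qed.

HB.instance Definition _ := Countable.copy ptree (can_type tree_encK).
HB.instance Definition _ := Countable.on forest.

Lemma forest_unitm (F G : forest) :
  F ++ G = [::] -> F = [::] /\ G = [::].
Proof. by case: F. Qed.

(* Plane forests form a monoid for concatenation; [{malg k[forest]}] is the   *)
(* algebra of this monoid.                                                    *)
HB.instance Definition _ := @Choice_isMonomialDef.Build forest
  [::] cat (@catA ptree) (@cat0s ptree) (@cats0 ptree) forest_unitm.

Fixpoint tsize (t : ptree) : nat :=
  let: Node ts := t in (sumn (map tsize ts)).+1.

Definition fsize (F : forest) : nat := sumn (map tsize F).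

Definition nroots (F : forest) : nat := size F.

Definition Bplus (F : forest) : ptree := Node F.

Fixpoint tree_polish (t : ptree) : seq nat :=
  let: Node ts := t in size ts :: flatten (map tree_polish ts).

Definition polish (F : forest) : seq nat := flatten (map tree_polish F).

Definition reverse_polish (F : forest) : seq nat := rev (polish F).

(* Vertices are identified with their postorder labels, counted from 0: in    *)
(* [Node ts] the root has label [fsize ts], after all the vertices of [ts];   *)
(* in [t :: F] the labels of [F] are shifted by [tsize t].                    *)

(* [forest_desc F i j] : i is a proper descendant of j, i.e. i <_F j. *)
Section Descendant.
Variable td : ptree -> rel nat.
Fixpoint desc_with (F : forest) (i j : nat) : bool :=
  if F is t :: F' then
    if (j < tsize t)%N then td t i j
    else (tsize t <= i)%N && desc_with F' (i - tsize t) (j - tsize t)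
  else false.
End Descendant.

Fixpoint tree_desc (t : ptree) (i j : nat) : bool :=
  let: Node ts := t in
  if j == fsize ts then (i < fsize ts)%N else desc_with tree_desc ts i j.

Definition forest_desc : forest -> rel nat := desc_with tree_desc.

(* [forest_restr F P] : restriction of F to the vertices whose label          *)
(* satisfies P; the descendants of a deleted vertex are attached to its       *)
(* closest surviving ancestor.                                                *)
Section Restriction.
Variable tr : ptree -> pred nat -> forest.
Fixpoint restr_with (F : forest) (P : pred nat) : forest :=
  if F is t :: F' then
    tr t P ++ restr_with F' (fun i => P (tsize t + i)%N)
  else [::].
End Restriction.

Fixpoint tree_restr (t : ptree) (P : pred nat) : forest :=
  let: Node ts := t in
  let G := restr_with tree_restr ts P in
  if P (fsize ts) then [:: Node G] else G.

Definition forest_restr : forest -> pred nat -> forest :=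
  restr_with tree_restr.

(* In [tamari_cover_at] the vertex x is [Node (s :: ts)], which is not a leaf *)
(* and not the root, having a parent with children [l ++ x :: r].             *)
Inductive tamari_cover : ptree -> ptree -> Prop :=
| tamari_cover_at (l r ts : forest) (s : ptree) :
    tamari_cover (Node (l ++ Node (s :: ts) :: r))
                 (Node (l ++ s :: Node ts :: r))
| tamari_cover_in (l r : forest) (t t' : ptree) :
    tamari_cover t t' ->
    tamari_cover (Node (l ++ t :: r)) (Node (l ++ t' :: r)).

Definition tamari_tree : ptree -> ptree -> Prop :=
  clos_refl_trans ptree tamari_cover.

Definition tamari (F G : forest) : Prop := tamari_tree (Bplus F) (Bplus G).

Local Open Scope classical_set_scope.

Lemma tamari_cover_size (t t' : ptree) :
  tamari_cover t t' -> tsize t = tsize t'.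
Proof.
elim=> {t t'} [l r ts s|l r t t' _ E] /=; rewrite !map_cat !sumn_cat /=.
  by rewrite !(addnS, addSn) !addnA.
by rewrite E.
Qed.

Lemma tamari_size (F G : forest) : tamari F G -> fsize F = fsize G.
Proof.
move=> h; suff: tsize (Bplus F) = tsize (Bplus G) by case.
elim: h => [t t' /tamari_cover_size //|//|t u v _ -> _ -> //].
Qed.

Lemma finite_forests (n : nat) : finite_set [set F | (fsize F <= n)%N].
Proof.
elim: n => [|n IH].
  apply: (sub_finite_set _ (finite_set1 ([::] : forest))).
  by case=> [|[ts] F].
apply: (sub_finite_set (B := [set [::]] `|`
  ((fun p : forest * forest => Node p.1 :: p.2) @`
     ([set F | (fsize F <= n)%N] `*` [set F | (fsize F <= n)%N])))).
  case=> [|[ts] F] /=; [by left | move=> h; right].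
  rewrite /fsize /= addSn ltnS in h.
  exists (ts, F) => //=; split; rewrite /=.
    exact: leq_trans (leq_addr _ _) h.
  exact: leq_trans (leq_addl _ _) h.
rewrite finite_setU; split; first exact: finite_set1.
exact/finite_image/finite_setX.
Qed.

(* Hence sums over all the forests above a given one are finite. *)
Lemma finite_tamari_up (F : forest) : finite_set [set G | tamari F G].
Proof.
apply: (sub_finite_set _ (finite_forests (fsize F))).
by move=> G /= /tamari_size ->.
Qed.

Definition bounded_below (K : nmodType) (f : int -> K) : Prop :=
  exists N : int, forall n : int, n < N -> f n = 0.

Record laurent (K : nmodType) : Type :=
  Laurent { lcoef : int -> K ; lcoefP : bounded_below lcoef }.

Lemma laurentP (K : nmodType) (f g : laurent K) : lcoef f =1 lcoef g -> f = g.
Proof.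
case: f g => [f hf] [g hg] /= /funext e; case: _ / e hg => hg.
by congr Laurent; exact: Prop_irrelevance.
Qed.

HB.instance Definition _ (K : nmodType) := gen_eqMixin (laurent K).
HB.instance Definition _ (K : nmodType) := gen_choiceMixin (laurent K).

(* The Laurent series c z^m. *)
Lemma lmono_subproof (K : nmodType) (c : K) (m : int) :
  bounded_below (fun n => if n == m then c else 0).
Proof. by exists m => n; case: ltgtP. Qed.

Definition lmono (K : nmodType) (c : K) (m : int) : laurent K :=
  Laurent (lmono_subproof c m).

Section LaurentZmod.
Variable K : zmodType.
Implicit Types f g : laurent K.

Lemma ladd_subproof f g : bounded_below (fun n => lcoef f n + lcoef g n).
Proof.
case: (lcoefP f) (lcoefP g) => [M hM] [N hN]; exists (Num.min M N) => n.
by rewrite lt_min => /andP[/hM -> /hN ->]; rewrite addr0.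
Qed.

Definition ladd f g : laurent K := Laurent (ladd_subproof f g).

Lemma lopp_subproof f : bounded_below (fun n => - lcoef f n).
Proof. by case: (lcoefP f) => [M hM]; exists M => n /hM ->; rewrite oppr0. Qed.

Definition lopp f : laurent K := Laurent (lopp_subproof f).

Lemma lzero_subproof : bounded_below (fun _ : int => 0 : K).
Proof. by exists 0. Qed.

Definition lzero : laurent K := Laurent lzero_subproof.

Lemma laddA : associative ladd.
Proof. by move=> f g h; apply: laurentP => n /=; rewrite addrA. Qed.

Lemma laddC : commutative ladd.
Proof. by move=> f g; apply: laurentP => n /=; rewrite addrC. Qed.

Lemma ladd0 : left_id lzero ladd.
Proof. by move=> f; apply: laurentP => n /=; rewrite add0r. Qed.

Lemma laddN : left_inverse lzero lopp ladd.
Proof. by move=> f; apply: laurentP => n /=; rewrite addNr. Qed.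

HB.instance Definition _ := GRing.isZmodule.Build (laurent K)
  laddA laddC ladd0 laddN.

End LaurentZmod.

Section LaurentRing.
Variable K : comNzRingType.
Implicit Types f g h : laurent K.

(* Cauchy product; the sum has finite support for Laurent series (see         *)
(* [lconvE]).                                                                 *)
Definition lconv (f g : int -> K) (n : int) : K :=
  \sum_(i \in [set: int]) f i * g (n - i).

Section Coefficients.
Variables (f g : int -> K) (M N : int).
Hypothesis hf : forall n, n < M -> f n = 0.
Hypothesis hg : forall n, n < N -> g n = 0.

Lemma lconv_lt n : n < M + N -> lconv f g n = 0.
Proof.
move=> hn; rewrite /lconv fsbig1 // => i _.
have [/hf->|hi] := ltP i M; first by rewrite mul0r.
by rewrite hg ?mulr0 // ltrBlDr (lt_le_trans hn) // addrC lerD2l.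
Qed.

Lemma lconvE (n : nat) : lconv f g (M + N + n%:Z) =
  \sum_(i < n.+1) f (M + i%:Z) * g (N + (n - i)%N%:Z).
Proof.
pose r := [seq M + i%:Z | i <- iota 0 n.+1].
have ur : uniq r by rewrite map_inj_uniq ?iota_uniq // => i j /addrI [].
rewrite /lconv -(@fsbig_widen _ _ _ _ [set` r]) //; last first.
  move=> i [_ /= hi].
  have [/hf->|Mi] := ltP i M; first by rewrite mul0r.
  rewrite hg ?mulr0 //.
  move: Mi; rewrite -subr_ge0; case E: (i - M) => [k|//] _.
  have {E} Ei : i = M + k%:Z by rewrite -E addrC subrK.
  have nk : (n < k)%N.
    rewrite ltnNge; apply/negP => kn; apply: hi.
    by rewrite Ei; apply/mapP; exists k; rewrite ?mem_iota.
  by rewrite Ei opprD addrACA (addrAC M N) subrr add0r gtrDl subr_lt0 ltz_nat.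
rewrite -(fsbig_seq _ _ ur) /r big_map -[iota 0 _]/(index_iota 0 n.+1).
rewrite big_mkord; apply: eq_bigr => i _; congr (_ * g _).
by rewrite opprD addrACA (addrAC M N) subrr add0r subzn -1?ltnS.
Qed.

End Coefficients.

Lemma lmul_subproof f g : bounded_below (lconv (lcoef f) (lcoef g)).
Proof.
case: (lcoefP f) (lcoefP g) => [M hM] [N hN].
by exists (M + N) => n; apply: lconv_lt.
Qed.

Definition lmul f g : laurent K := Laurent (lmul_subproof f g).

Definition lone : laurent K := lmono 1 0.

(* z^-M f truncated to a polynomial, used to inherit the ring axioms of       *)
(* polynomials.                                                               *)
Let ltrunc (L : nat) (f : int -> K) (M : int) : {poly K} :=
  \poly_(i < L) f (M + i%:Z).

Let lconv_trunc (L n : nat) (f g : int -> K) (M N : int) :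
  (forall n, n < M -> f n = 0) -> (forall n, n < N -> g n = 0) -> (n < L)%N ->
  lconv f g (M + N + n%:Z) = (ltrunc L f M * ltrunc L g N)`_n.
Proof.
move=> hf hg nL; rewrite (lconvE hf hg) coefM; apply: eq_bigr => i _.
rewrite !coef_poly (leq_ltn_trans (leq_ord i) nL).
by rewrite (leq_ltn_trans (leq_subr _ _) nL).
Qed.

Let coefM_eq (n : nat) (p p' q q' : {poly K}) :
  (forall i, (i <= n)%N -> p`_i = p'`_i) ->
  (forall i, (i <= n)%N -> q`_i = q'`_i) -> (p * q)`_n = (p' * q')`_n.
Proof.
move=> hp hq; rewrite !coefM; apply: eq_bigr => i _.
by rewrite hp ?leq_ord // hq ?leq_subr.
Qed.

Let ge_bound (M n : int) : M <= n -> exists k : nat, n = M + k%:Z.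
Proof.
rewrite -subr_ge0; case E: (n - M) => [k|//] _.
by exists k; rewrite -E addrC subrK.
Qed.

Lemma lmulC : commutative lmul.
Proof.
move=> f g; apply: laurentP => n /=.
case: (lcoefP f) (lcoefP g) => [M hM] [N hN].
have [nlt|/ge_bound[k ->]] := ltP n (M + N).
  by rewrite (lconv_lt hM hN) // (lconv_lt hN hM) // addrC.
rewrite (lconv_trunc hM hN (ltnSn k)) mulrC.
by rewrite -(lconv_trunc hN hM (ltnSn k)) (addrC N).
Qed.

Lemma lmulA : associative lmul.
Proof.
move=> f g h; apply: laurentP => n /=.
case: (lcoefP f) (lcoefP g) (lcoefP h) => [M hM] [N hN] [P hP].
have hMN m : m < M + N -> lconv (lcoef f) (lcoef g) m = 0 by apply: lconv_lt.
have hNP m : m < N + P -> lconv (lcoef g) (lcoef h) m = 0 by apply: lconv_lt.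
have [nlt|/ge_bound[k ->]] := ltP n (M + N + P).
  by rewrite (lconv_lt hMN hP) // (lconv_lt hM hNP) // addrA.
rewrite (lconv_trunc hMN hP (ltnSn k)) -(addrA M).
rewrite (lconv_trunc hM hNP (ltnSn k)).
pose t := @ltrunc k.+1.
transitivity ((t (lcoef f) M * t (lcoef g) N * t (lcoef h) P)`_k).
  rewrite -mulrA; apply: coefM_eq => // i ik.
  by rewrite coef_poly ltnS ik; apply: lconv_trunc.
apply: coefM_eq => // i ik.
by rewrite coef_poly ltnS ik; apply/esym/lconv_trunc.
Qed.

Lemma lmul1 : left_id lone lmul.
Proof.
move=> f; apply: laurentP => n /=; case: (lcoefP f) => [M hM].
have h1 m : m < 0 -> lcoef lone m = 0 by move=> /=; case: ltgtP.
have [nlt|/ge_bound[k ->]] := ltP n M.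
  by rewrite (lconv_lt h1 hM) ?add0r // hM.
rewrite -{1}(add0r M) (lconvE h1 hM) big_ord_recl /= subn0 mul1r.
by rewrite big1 ?addr0 // => i _; rewrite mul0r.
Qed.

Lemma lmulDl : left_distributive lmul +%R.
Proof.
move=> f g h; apply: laurentP => n /=.
case: (lcoefP f) (lcoefP g) (lcoefP h) => [M0 hM0] [N0 hN0] [P hP].
pose M := Num.min M0 N0.
have hM m : m < M -> lcoef f m = 0 by rewrite lt_min => /andP[/hM0].
have hN m : m < M -> lcoef g m = 0 by rewrite lt_min => /andP[_ /hN0].
have hD m : m < M -> lcoef f m + lcoef g m = 0.
  by move=> mM; rewrite hM ?hN ?addr0.
have [nlt|/ge_bound[k ->]] := ltP n (M + P).
  by rewrite (lconv_lt hD hP) // (lconv_lt hM hP) // (lconv_lt hN hP) // addr0.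
rewrite (lconvE hD hP) (lconvE hM hP) (lconvE hN hP) -big_split /=.
by apply: eq_bigr => i _; rewrite mulrDl.
Qed.

Lemma lone_neq0 : lone != 0.
Proof.
apply/eqP => /(congr1 (fun f => lcoef f 0)) /= /eqP.
by rewrite oner_eq0.
Qed.

HB.instance Definition _ := GRing.Zmodule_isComNzRing.Build (laurent K)
  lmulA lmulC lmul1 lmulDl lone_neq0.

End LaurentRing.

Section LaurentAlg.
Variables (k : comNzRingType) (K : comAlgType k).
Implicit Types f g : laurent K.

Lemma lscale_subproof (c : k) f : bounded_below (fun n => c *: lcoef f n).
Proof. by case: (lcoefP f) => [M hM]; exists M => n /hM ->; rewrite scaler0. Qed.

Definition lscale (c : k) f : laurent K := Laurent (lscale_subproof c f).

Lemma lscaleA (a b : k) f : lscale a (lscale b f) = lscale (a * b) f.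
Proof. by apply: laurentP => n /=; rewrite scalerA. Qed.

Lemma lscale1 : left_id 1 lscale.
Proof. by move=> f; apply: laurentP => n /=; rewrite scale1r. Qed.

Lemma lscaleDr : right_distributive lscale +%R.
Proof. by move=> a f g; apply: laurentP => n /=; rewrite scalerDr. Qed.

Lemma lscaleDl f : {morph lscale^~ f : a b / a + b}.
Proof. by move=> a b; apply: laurentP => n /=; rewrite scalerDl. Qed.

HB.instance Definition _ := GRing.Zmodule_isLmodule.Build k (laurent K)
  lscaleA lscale1 lscaleDr lscaleDl.

Lemma lscaleAl (a : k) f g : a *: (f * g) = (a *: f) * g.
Proof.
apply: laurentP => n /=.
case: (lcoefP f) (lcoefP g) => [M hM] [N hN].
have hZ m : m < M -> a *: lcoef f m = 0 by move=> /hM ->; rewrite scaler0.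
have [nlt|] := ltP n (M + N).
  by rewrite (lconv_lt hM hN) // (lconv_lt hZ hN) // scaler0.
rewrite -subr_ge0; case E: (n - _) => [j|//] _.
have -> : n = M + N + j%:Z by rewrite -E addrC subrK.
rewrite (lconvE hM hN) (lconvE hZ hN) scaler_sumr.
by apply: eq_bigr => i _; rewrite scalerAl.
Qed.

HB.instance Definition _ := GRing.Lmodule_isLalgebra.Build k (laurent K)
  lscaleAl.

End LaurentAlg.

(* A_+ = z^-1 K[z^-1] and A_- = K[[z]], as subsets of A = K((z)). *)
Definition polar_part (K : nmodType) : set (laurent K) :=
  [set f | forall n : int, 0 <= n -> lcoef f n = 0].

Definition regular_part (K : nmodType) : set (laurent K) :=
  [set f | forall n : int, n < 0 -> lcoef f n = 0].

Notation HNCK k := {malg k[forest]}.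

(* H_NCK (x) H_NCK, with basis Y_F (x) Y_G indexed by the pairs (F, G) *)
Notation HNCK2 k := {malg k[(forest * forest)%type]}.

(* k[a_0, a_1, ...] *)
Notation coef_ring k := {malg k[{cmonom nat}]}.

Section HopfAlgebra.
Variable k : comNzRingType.

Definition Y (F : forest) : HNCK k := << F >>.

Definition Y2 (F G : forest) : HNCK2 k := << (F, G) >>.

(* Words in {1, 2}^|F|, the letter 1 being [false] and the letter 2 [true];   *)
(* the comparison is in nat, through the coercion from bool.                  *)
Definition cut_word (F : forest) (u : (fsize F).-tuple bool) : bool :=
  [forall i : 'I_(fsize F), forall j : 'I_(fsize F),
     forest_desc F i j ==> (tnth u i <= tnth u j)%N].

Definition word_restr (F : forest) (u : (fsize F).-tuple bool) (b : bool) :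
  forest := forest_restr F (fun i => nth false u i == b).

Definition coprodY (F : forest) : HNCK2 k :=
  \sum_(u : (fsize F).-tuple bool | cut_word u)
     Y2 (word_restr u false) (word_restr u true).

Definition coprod (x : HNCK k) : HNCK2 k :=
  \sum_(F <- msupp x) x@_F *: coprodY F.

Definition convolution (A : lalgType k) (f g : HNCK k -> A) (x : HNCK k) : A :=
  \sum_(p <- msupp (coprod x)) (coprod x)@_p *: (f (Y p.1) * g (Y p.2)).

Definition a_ (n : nat) : coef_ring k := << ucm n >>.

Definition a_forest (F : forest) : coef_ring k :=
  \prod_(c <- reverse_polish F) a_ c.

(* a(z) = sum_(n >= 0) a_n z^(n-1) *)
Definition a_coef (m : int) : coef_ring k :=
  if m + 1 is Posz n then a_ n else 0.

Lemma a_coef_bounded : bounded_below a_coef.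
Proof.
exists (-1) => n hn; rewrite /a_coef; case E: (n + 1) => [m|//].
by move: hn; rewrite -subr_lt0 opprK E.
Qed.

Definition a_series : laurent (coef_ring k) := Laurent a_coef_bounded.

Definition character := {lrmorphism HNCK k -> laurent (coef_ring k)}.

Definition birkhoff (phi phi_plus phi_minus : character) : Prop :=
  [/\ phi_plus =1 convolution phi_minus phi,
      forall F : forest, F != [::] -> polar_part (phi_plus (Y F)) &
      forall F : forest, F != [::] -> regular_part (phi_minus (Y F))].

End HopfAlgebra.

Arguments Y {k} F.

(* Main.v *)
Require Import Defs.
From Stdlib Require Import Relations.Relation_Operators.
From mathcomp Require Import all_boot all_order all_algebra.
From mathcomp Require Import boolp classical_sets fsbigop reals complex finmap.
From mathcomp Require Import zify.
From mathcomp.multinomials Require Import monalg.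

Set Implicit Arguments.
Unset Strict Implicit.
Unset Printing Implicit Defensive.

Import Order.TTheory GRing.Theory Num.Theory.

(** The idea is to compute both sides by the same recursion on plane forests.

    On the analytic side, a vertex word on [B_+(F)] either is constantly 1, or
    gives the letter 2 to the root and restricts to an arbitrary admissible
    word of [F].  As [phi] only sees the number of vertices, this gives

      [phi_plus (B_+ F) = phi_minus (B_+ F) + a(z) * phi_plus F]

    ([convolution_tree]).  The left side is polar and [phi_minus (B_+ F)] is
    regular, so [phi_plus (B_+ F)] is the polar part of [a(z) * phi_plus F];
    on forests, [phi_plus] is multiplicative.

    On the combinatorial side, the forests above a concatenation are the
    concatenations of forests above each factor, and the forests above
    [B_+(F)] are exactly the [l ++ [B_+(r)]] with [l ++ r] above [F]: moving
    the leftmost subtree of the root of the last tree out of it moves one tree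
    from [r] to [l] and leaves [l ++ r] unchanged, while every other move of
    [l ++ [B_+(r)]] is a move of [l ++ r].  Hence the up-sets are enumerated,
    without repetition, by a recursive function [up_forest] ([up_forestP],
    [uniq_up_forest]).

    The two recursions agree because, if [G] has [r] trees, the polar part of
    [a(z) a_G z^(-r)] is the sum of the [a_m a_G z^(m-1-r)] for [m <= r], and
    the term of index [m] is the contribution of the forest obtained from [G]
    by grafting its last [m] trees on a new root ([mul_a_weight_regular]). *)

(** * Induction on plane forests *)

(** Viewing a forest as a binary tree (children of the first root, remaining
    trees) avoids the nested induction on plane trees. *)
Lemma forest_ind (P : forest -> Prop) :
  P [::] -> (forall F G, P F -> P G -> P (Node F :: G)) -> forall F, P F.
Proof.
move=> P0 PS F; suff Pt : forall t, P (let: Node ts := t in ts).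
  exact: (Pt (Node F)).
fix IH 1; case; elim=> [|t ts IHts] //.
by move: (IH t); case: t => us Pus; apply: PS Pus IHts.
Qed.

Lemma fsize_cons F G : fsize (Node F :: G) = ((fsize F).+1 + fsize G)%N.
Proof. by []. Qed.

(** * Tamari covers of forests *)

(** What a cover of [Node F] does to the tree of [F] in which it takes place:
    the tree is replaced by the given forest. *)
Inductive local_move : ptree -> forest -> Prop :=
| move_left s ts : local_move (Node (s :: ts)) [:: s; Node ts]
| move_inside t t' : tamari_cover t t' -> local_move t [:: t'].

Lemma tamari_coverP F H :
  tamari_cover (Node F) (Node H) <->
  exists l r x X, [/\ F = l ++ x :: r, H = l ++ X ++ r & local_move x X].
Proof.
split=> [c|[l] [r] [x] [X] [-> -> []]]; last 2 first.
- by move=> s ts; apply: tamari_cover_at.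
- by move=> t t'; apply: tamari_cover_in.
inversion c as [l r ts s|l r t t' ct]; subst.
- exists l, r, (Node (s :: ts)), [:: s; Node ts].
  by split=> //; apply: move_left.
- by exists l, r, t, [:: t']; split=> //; apply: move_inside.
Qed.

Lemma tamari_cover_ctx (l r F G : forest) :
  tamari_cover (Node F) (Node G) ->
  tamari_cover (Node (l ++ F ++ r)) (Node (l ++ G ++ r)).
Proof.
move=> /tamari_coverP[l' [r' [x [X [-> -> mv]]]]].
by apply/tamari_coverP; exists (l ++ l'), (r' ++ r), x, X; rewrite -!catA.
Qed.

Lemma cat_cons_eq_cat (X : Type) (l r A B : seq X) x : l ++ x :: r = A ++ B ->
  (exists2 r1, A = l ++ x :: r1 & r = r1 ++ B) \/
  (exists2 l2, l = A ++ l2 & B = l2 ++ x :: r).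
Proof.
elim: A l => [|a A IH] [|y l] /=.
- by move=> <-; right; exists [::].
- by move=> <-; right; exists (y :: l).
- by case=> -> ->; left; exists A.
- case=> -> /IH [[r1 -> ->]|[l2 -> ->]].
  + by left; exists r1.
  + by right; exists l2.
Qed.

(** A cover of a forest happens inside a single tree, hence inside one of two
    concatenated factors. *)
Lemma tamari_cover_cat A B H : tamari_cover (Node (A ++ B)) (Node H) ->
  (exists2 A', H = A' ++ B & tamari_cover (Node A) (Node A')) \/
  (exists2 B', H = A ++ B' & tamari_cover (Node B) (Node B')).
Proof.
move=> /tamari_coverP[l [r [x [X [/esym E -> mv]]]]].
have [[r1 -> ->]|[l2 -> ->]] := cat_cons_eq_cat E.
- left; exists (l ++ X ++ r1); rewrite -?catA //.
  by apply/tamari_coverP; exists l, r1, x, X.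
- right; exists (l2 ++ X ++ r); rewrite -?catA //.
  by apply/tamari_coverP; exists l2, r, x, X.
Qed.

Lemma tamari_cover_tree F H : tamari_cover (Node [:: Node F]) (Node H) ->
  (exists s ts, F = s :: ts /\ H = [:: s; Node ts]) \/
  (exists2 F', H = [:: Node F'] & tamari_cover (Node F) (Node F')).
Proof.
move=> /tamari_coverP[[|? [|? ?]] [r [x [X []]]]] //= [<- <-] ->.
rewrite cats0 {r} => mv; inversion mv as [s ts|t [F'] c]; subst.
- by left; exists s, ts.
- by right; exists F'.
Qed.

Lemma tamari_cover_nil H : ~ tamari_cover (Node [::]) (Node H).
Proof. by case/tamari_coverP => [[|? ?]] [r [x [X []]]]. Qed.

(** * The Tamari order and concatenation *)

Lemma tamari_refl F : tamari F F.
Proof. exact: rt_refl. Qed.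

Lemma tamari_trans G F H : tamari F G -> tamari G H -> tamari F H.
Proof. exact: rt_trans. Qed.

(** Lifts to the order a property of covers.  The order is a closure on trees
    rather than on forests, so [C] is precomposed with the list of children
    before the induction. *)
Lemma tamari_ctx (C : forest -> forest) :
  (forall F G, tamari_cover (Node F) (Node G) -> tamari (C F) (C G)) ->
  forall F G, tamari F G -> tamari (C F) (C G).
Proof.
move=> hC F G; rewrite {1}/tamari /Bplus /tamari_tree.
pose ch t := let: Node ts := t in ts.
rewrite -[X in tamari (C X)]/(ch (Node F)) -[X in tamari _ (C X)]/(ch (Node G)).
elim=> {F G} [[F] [G] /hC //|t|t u v _ h1 _ h2].
- exact: tamari_refl.
- exact: tamari_trans h1 h2.
Qed.

Lemma tamari_cat F F' G G' :
  tamari F F' -> tamari G G' -> tamari (F ++ G) (F' ++ G').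
Proof.
move=> hF hG; apply: (@tamari_trans (F' ++ G)).
- apply: (tamari_ctx (C := cat^~ G)) hF => {}F {}F' c.
  exact/rt_step/(tamari_cover_ctx [::] G).
- apply: (tamari_ctx (C := cat F')) hG => {}G {}G' c.
  by apply: rt_step; have := tamari_cover_ctx F' [::] c; rewrite !cats0.
Qed.

Lemma tamari_Node F G : tamari F G -> tamari [:: Node F] [:: Node G].
Proof.
apply: (tamari_ctx (C := fun F => [:: Node F])) => {}F {}G c.
by apply/rt_step/(tamari_cover_in [::] [::]).
Qed.

(** The trees of [l] leave the root one after the other, each of them as the
    leftmost subtree at its turn. *)
Lemma tamari_graft (l r : forest) :
  tamari [:: Node (l ++ r)] (l ++ [:: Node r]).
Proof.
elim: l => [|s l IH]; first exact: tamari_refl.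
apply: (@tamari_trans ([:: s] ++ [:: Node (l ++ r)])).
- exact/rt_step/(tamari_cover_at [::] [::]).
- exact: tamari_cat (tamari_refl _) IH.
Qed.

(** * Enumeration of the forests above a given one *)

(** Inverse of [l ++ [:: Node r] |-> l ++ r] on the forests with [n + 1]
    roots. *)
Definition graft_from (G : forest) (n : nat) : forest :=
  take n G ++ [:: Node (drop n G)].

(** The body of [up_forest] is repeated inside the fixpoint, as a fold, so that
    the recursive calls are structural. *)
Fixpoint up_tree (t : ptree) : seq forest :=
  let: Node ts := t in
  let up_children :=
    foldr (fun s Hs => [seq G ++ H | G <- up_tree s, H <- Hs]) [:: [::]] ts in
  [seq graft_from G n | G <- up_children, n <- iota 0 (size G).+1].

Definition up_forest (F : forest) : seq forest :=
  foldr (fun s Hs => [seq G ++ H | G <- up_tree s, H <- Hs]) [:: [::]] F.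

Lemma up_tree_Node F : up_tree (Node F) =
  [seq graft_from G n | G <- up_forest F, n <- iota 0 (size G).+1].
Proof. by []. Qed.

Lemma up_forest_cons t F : up_forest (t :: F) =
  [seq G ++ H | G <- up_tree t, H <- up_forest F].
Proof. by []. Qed.

Arguments up_tree : simpl never.
Arguments up_forest : simpl never.

Lemma up_forest_consP t F (H : forest) :
  reflect (exists A B : forest,
             [/\ H = A ++ B, A \in up_tree t & B \in up_forest F])
          (H \in up_forest (t :: F)).
Proof.
rewrite up_forest_cons; apply: (iffP allpairsP) => [[[A B] []]|[A [B []]]].
- by exists A, B.
- by exists (A, B).
Qed.

Lemma up_forest1 t : up_forest [:: t] = up_tree t.
Proof.
rewrite up_forest_cons [up_forest [::]]/=; elim: (up_tree t) => //= G Gs ->.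
by rewrite cats0.
Qed.

Lemma up_treeP F (H : forest) :
  reflect (exists l r : forest, H = l ++ [:: Node r] /\ l ++ r \in up_forest F)
          (H \in up_tree (Node F)).
Proof.
rewrite up_tree_Node; apply: (iffP allpairsPdep).
- case=> G [n [GF _ ->]]; exists (take n G), (drop n G).
  by rewrite cat_take_drop.
- case=> l [r [-> lrF]]; exists (l ++ r), (size l); split=> //.
  + by rewrite mem_iota add0n ltnS size_cat leq_addr.
  + by rewrite /graft_from take_size_cat // drop_size_cat.
Qed.

Lemma tamari_up_forest F (H : forest) : H \in up_forest F -> tamari F H.
Proof.
elim/forest_ind: F H => [|F G IHF IHG] H.
  by rewrite inE => /eqP->; apply: tamari_refl.
case/up_forest_consP=> A [B [-> /up_treeP[l [r [-> lr]]] BG]].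
apply: (tamari_cat (F := [:: Node F])) (IHG _ BG).
exact: tamari_trans (tamari_Node (IHF _ lr)) (tamari_graft l r).
Qed.

Lemma up_forest_refl F : F \in up_forest F.
Proof.
elim/forest_ind: F => [|F G IHF IHG]; first by rewrite inE.
apply/up_forest_consP; exists [:: Node F], G; split=> //.
by apply/up_treeP; exists [::], F.
Qed.

(** Completeness of the enumeration: the up-set of [F] is generated from [F] by
    covers, so it is enough that the enumeration is closed under them. *)
Lemma up_forest_cover F (G H : forest) :
  tamari_cover (Node G) (Node H) -> G \in up_forest F -> H \in up_forest F.
Proof.
move=> c GF; elim/forest_ind: F G GF H c => [|F1 F2 IH1 IH2] G.
  by rewrite inE => /eqP-> H /tamari_cover_nil.
case/up_forest_consP=> A [B [-> AF BF]] H.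
case/tamari_cover_cat => [[A' -> c]|[B' -> c]]; last first.
  by apply/up_forest_consP; exists A, B'; split=> //; apply: IH2 c.
apply/up_forest_consP; exists A', B; split=> //.
case/up_treeP: AF c => l [r [-> lr]] /tamari_cover_cat[[l' -> c]|[X' -> c]].
  apply/up_treeP; exists l', r; split=> //; apply: IH1 lr _ _.
  exact: (tamari_cover_ctx [::]).
case/tamari_cover_tree: c => [[s [ts [er ->]]]|[r' -> c]]; apply/up_treeP.
  (* the leftmost subtree leaves the last tree: [l ++ r] does not change *)
  by exists (rcons l s), ts; rewrite -cats1 -!catA /= -er.
exists l, r'; split=> //; apply: IH1 lr _ _.
by have := tamari_cover_ctx l [::] c; rewrite !cats0.
Qed.

Lemma up_forestP F (H : forest) : H \in up_forest F <-> tamari F H.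
Proof.
split; first exact: tamari_up_forest.
move=> FH; have := up_forest_refl F; move: FH.
rewrite {1}/tamari /Bplus /tamari_tree.
pose ch t : forest := let: Node ts := t in ts.
rewrite -{-1}[H]/(ch (Node H)) -{2}[F]/(ch (Node F)).
move: (Node F) (Node H) => t u.
elim=> {t u H} [[A] [B]|t|t u v _ h1 _ h2 /h1 /h2] //.
exact: up_forest_cover.
Qed.

Lemma fsize_up_forest F (H : forest) : H \in up_forest F -> fsize H = fsize F.
Proof. by move=> /tamari_up_forest/tamari_size. Qed.

(** Since the order preserves the number of vertices, this makes the
    decomposition [H = A ++ B] of a forest above [F ++ G] unique. *)
Lemma cat_inj_fsize A B A' B' :
  fsize A = fsize A' -> A ++ B = A' ++ B' -> A = A' /\ B = B'.
Proof.
elim: A A' => [|[ts] A IH] [|[us] A'] // e [et]; subst us.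
by case/IH=> [|-> ->] //; move: e; rewrite !fsize_cons => /addnI.
Qed.

Lemma uniq_up_forest F : uniq (up_forest F).
Proof.
elim/forest_ind: F => [//|F G uF uG]; rewrite up_forest_cons.
apply: allpairs_uniq => //; last first.
  move=> _ _ /allpairsP[[A B] [AF BG ->]] /allpairsP[[A' B'] [AF' BG' ->]].
  move: AF AF'; rewrite -up_forest1 /= => /fsize_up_forest AF.
  by move=> /fsize_up_forest AF' /cat_inj_fsize[|-> -> //]; rewrite AF.
rewrite up_tree_Node; apply: allpairs_uniq_dep => //.
  by move=> A _; apply: iota_uniq.
move=> _ _ /allpairsPdep[A [n [_ + ->]]] /allpairsPdep[B [m [_ + ->]]].
rewrite !mem_iota !add0n !ltnS /= => nA mB; rewrite /graft_from !cats1.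
move=> /rcons_inj[et ed].
(* the forest determines [G] and the number of its trees left ungrafted *)
have eAB : A = B by rewrite -(cat_take_drop n A) et ed cat_take_drop.
subst B; suff -> : n = m by [].
by have := congr1 size et; rewrite !size_take_min (minn_idPl nA) (minn_idPl mB).
Qed.

(** * Admissible words and restrictions *)

Lemma fsize1 F : fsize [:: Node F] = (fsize F).+1.
Proof. exact: addn0. Qed.

Lemma forest_desc_cons F G i j : forest_desc (Node F :: G) i j =
  if (j < (fsize F).+1)%N then
    if j == fsize F then (i < fsize F)%N else forest_desc F i j
  else ((fsize F).+1 <= i)%N &&
       forest_desc G (i - (fsize F).+1) (j - (fsize F).+1).
Proof. by []. Qed.

Lemma forest_restr_cons F G P : forest_restr (Node F :: G) P =
  (if P (fsize F) then [:: Node (forest_restr F P)] else forest_restr F P) ++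
  forest_restr G (fun i => P ((fsize F).+1 + i)%N).
Proof. by []. Qed.

(** Postorder labels every vertex after its descendants, so only the label of
    the larger vertex has to be bounded in the conditions below. *)
Lemma forest_desc_lt F i j : forest_desc F i j -> (i < j)%N.
Proof.
elim/forest_ind: F i j => [//|F G IHF IHG] i j; rewrite forest_desc_cons.
case: ltnP => [_|hj].
  by case: eqP => [->|_] //; apply: IHF.
case/andP=> hi /IHG; rewrite -(ltn_add2l (fsize F).+1) !subnKC //.
Qed.

Lemma eq_forest_restr F P Q :
  (forall i, i < fsize F -> P i = Q i)%N -> forest_restr F P = forest_restr F Q.
Proof.
elim/forest_ind: F P Q => [//|F G IHF IHG] P Q; rewrite fsize_cons => e.
rewrite !forest_restr_cons e ?addSn ?ltnS ?leq_addr //.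
rewrite (IHF P Q) => [|i hi]; last first.
  by rewrite e // addSn ltnS (leq_trans (ltnW hi)) ?leq_addr.
by congr (_ ++ _); apply: IHG => i hi; rewrite e // ltn_add2l.
Qed.

Lemma forest_restrT F : forest_restr F predT = F.
Proof.
elim/forest_ind: F => [//|F G IHF IHG]; rewrite forest_restr_cons /= IHF.
by congr (_ :: _).
Qed.

Lemma forest_restr0 F : forest_restr F pred0 = [::].
Proof.
by elim/forest_ind: F => [//|F G IHF IHG]; rewrite forest_restr_cons /= IHF.
Qed.

(** Words as plain sequences: a word of [B_+(F)] is [rcons v b], with [b] the
    letter of the root, and the types of tuples over [fsize [:: Node F]] and
    [(fsize F).+1] differ. *)
Definition cut_seq (F : forest) (s : seq bool) : Prop :=
  forall i j, forest_desc F i j -> (j < fsize F)%N ->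
    (nth false s i <= nth false s j)%N.

Definition seq_restr F (s : seq bool) b :=
  forest_restr F (fun i => nth false s i == b).

Lemma cut_wordP F (u : (fsize F).-tuple bool) :
  reflect (cut_seq F u) (cut_word u).
Proof.
apply: (iffP forallP) => [h i j d jF|h i].
- have iF := ltn_trans (forest_desc_lt d) jF.
  move/(_ (Ordinal iF))/forallP/(_ (Ordinal jF))/implyP/(_ d): h.
  by rewrite !(tnth_nth false).
- apply/forallP => j; apply/implyP => d.
  by rewrite !(tnth_nth false); apply: h.
Qed.

(** A root with the letter 2 imposes nothing on its descendants. *)
Lemma cut_seq_root2 F v : size v = fsize F ->
  cut_seq [:: Node F] (rcons v true) <-> cut_seq F v.
Proof.
move=> sv; split=> h i j.
- move=> d jF; have iF := ltn_trans (forest_desc_lt d) jF.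
  have := h i j; rewrite !nth_rcons sv iF jF; apply.
  + by rewrite forest_desc_cons ltnS (ltnW jF) ltn_eqF.
  + by rewrite fsize1 ltnW.
- rewrite forest_desc_cons fsize1 => + jF; rewrite jF !nth_rcons sv.
  case: eqP => [-> _|/eqP ne]; first by rewrite ltnn; apply: leq_b1.
  have {ne}jF : (j < fsize F)%N by rewrite ltn_neqAle ne -ltnS.
  move=> d; rewrite jF (ltn_trans (forest_desc_lt d) jF).
  exact: h.
Qed.

(** A root with the letter 1 forces the same letter on the whole tree. *)
Lemma cut_seq_root1 F v : size v = fsize F ->
  cut_seq [:: Node F] (rcons v false) <-> v = nseq (fsize F) false.
Proof.
move=> sv; split=> [h|->].
- apply: (@eq_from_nth _ false) => [|i]; first by rewrite size_nseq.
  rewrite sv nth_nseq => iF; rewrite iF.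
  have := h i (fsize F); rewrite forest_desc_cons ltnSn eqxx fsize1 ltnSn.
  move=> /(_ iF isT); rewrite !nth_rcons sv iF ltnn eqxx leqn0 eqb0.
  by move/negbTE.
- by move=> i j _ _; rewrite !nth_rcons !nth_nseq !if_same.
Qed.

Lemma seq_restr_rcons F v b c : size v = fsize F ->
  seq_restr [:: Node F] (rcons v b) c =
  if b == c then [:: Node (seq_restr F v c)] else seq_restr F v c.
Proof.
move=> sv; rewrite /seq_restr forest_restr_cons cats0 nth_rcons sv ltnn eqxx.
rewrite (eq_forest_restr (Q := fun i => nth false v i == c)) // => i iF.
by rewrite nth_rcons sv iF.
Qed.

Lemma seq_restr_nseq F b c :
  seq_restr F (nseq (fsize F) b) c = if b == c then F else [::].
Proof.
rewrite /seq_restr (eq_forest_restr (Q := fun=> b == c)) => [|i iF].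
  by case: (b == c); [apply: forest_restrT | apply: forest_restr0].
by rewrite nth_nseq iF.
Qed.

Local Open Scope ring_scope.

(** * Convolution on trees *)

Lemma coprod_Y (k : comNzRingType) F : coprod (Y F) = coprodY k F.
Proof. by rewrite /coprod msuppU1 big_seq_fset1 mcoeffUU scale1r. Qed.

Lemma sum_tuple_rcons (A : nmodType) n (P : pred (seq bool))
    (h : seq bool -> A) :
  \sum_(u : n.+1.-tuple bool | P u) h u =
  \sum_(v : n.-tuple bool | P (rcons v true)) h (rcons v true) +
  \sum_(v : n.-tuple bool | P (rcons v false)) h (rcons v false).
Proof.
pose e (p : bool * n.-tuple bool) := [tuple of rcons p.2 p.1].
have e_bij : bijective e.
  apply: inj_card_bij => [[b v] [c w] /(congr1 val) /= /rcons_inj[]|].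
    by move=> /val_inj -> ->.
  by rewrite card_prod !card_tuple card_bool expnS.
rewrite (reindex e) /=; last exact: onW_bij.
rewrite -(pair_big_dep xpredT (fun b (v : n.-tuple bool) => P (rcons v b))
            (fun b (v : n.-tuple bool) => h (rcons v b))) /=.
by rewrite big_bool.
Qed.

(** [convolution] sums over the support of the coproduct, where equal terms are
    collected; extending [p |-> f p.1 * g p.2] linearly recovers the sum over
    words.  The length is a variable [n] so that it can be read as
    [(fsize F).+1] on a tree. *)
Lemma convolution_Y (k : comNzRingType) (A : lalgType k) (f g : HNCK k -> A)
    n F : fsize F = n ->
  convolution f g (Y F) =
  \sum_(u : n.-tuple bool | `[< cut_seq F u >])
     f (Y (seq_restr F u false)) * g (Y (seq_restr F u true)).
Proof.
case: n /; pose h (p : forest * forest) := f (Y p.1) * g (Y p.2).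
rewrite /convolution coprod_Y.
transitivity (mmap (GRing.in_alg A) h (coprodY k F)).
  by apply: eq_bigr => p _; rewrite -mulr_algl.
rewrite /coprodY raddf_sum; apply: eq_big => u.
  exact/cut_wordP/asboolP.
by rewrite [LHS]mmapU /= scale1r mul1r.
Qed.

(** The first term comes from the word that is constantly 1, the second from the
    words with the letter 2 at the root: there the right factor gains one
    vertex, that is one factor [a]. *)
Lemma convolution_tree (k : comNzRingType) (K : comAlgType k)
    (f g : HNCK k -> laurent K) (a : laurent K) :
  (forall F, g (Y F) = a ^+ fsize F) -> forall F,
  convolution f g (Y [:: Node F]) =
    f (Y [:: Node F]) + a * convolution f g (Y F).
Proof.
move=> gE F; rewrite (convolution_Y _ _ (fsize1 F)).
rewrite (convolution_Y _ _ (erefl (fsize F))).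
rewrite (sum_tuple_rcons _ (fun u => `[< cut_seq [:: Node F] u >])
  (fun u => f (Y (seq_restr [:: Node F] u false)) *
            g (Y (seq_restr [:: Node F] u true)))) addrC; congr (_ + _).
- rewrite (big_pred1 [tuple of nseq (fsize F) false]) => [|v].
    rewrite !seq_restr_rcons ?size_nseq // !seq_restr_nseq /=.
    by rewrite gE expr0 mulr1.
  have /propext -> := cut_seq_root1 (size_tuple v).
  apply/asboolP/eqP => [h|->] //; exact: val_inj.
- rewrite mulr_sumr; apply: eq_big => v.
    by have /propext -> := cut_seq_root2 (size_tuple v).
  rewrite !seq_restr_rcons ?size_tuple //= !gE fsize1 exprS.
  by rewrite mulrCA.
Qed.

(** * Laurent series *)

Section Laurent.
Variable K : comNzRingType.
Implicit Types f g : laurent K.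

Lemma lcoefB f g n : lcoef (f - g) n = lcoef f n - lcoef g n.
Proof. by []. Qed.

Lemma lcoef_sum (I : Type) (s : seq I) (f : I -> laurent K) n :
  lcoef (\sum_(i <- s) f i) n = \sum_(i <- s) lcoef (f i) n.
Proof. by elim/big_ind2: _ => // x1 y1 x2 y2 <- <-. Qed.

Lemma lcoef_mul_lmono f c m n :
  lcoef (f * lmono c m) n = lcoef f (n - m) * c.
Proof.
rewrite -[LHS]/(lconv _ _ n) /lconv -(fsbig_widen [set (n - m)]) //=.
  by rewrite fsbig_set1 subKr eqxx.
move=> i [_ /= ne]; case: eqP => [e|]; rewrite ?mulr0 //.
by case: ne; rewrite -e subKr.
Qed.

Lemma lmonoM c d m n :
  lmono c m * lmono d n = lmono (c * d) (m + n) :> laurent K.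
Proof.
apply: laurentP => i; rewrite lcoef_mul_lmono /= subr_eq.
by case: eqP => // _; rewrite mul0r.
Qed.

Lemma polar_sum (I : eqType) (s : seq I) (f : I -> laurent K) :
  (forall i, i \in s -> polar_part (f i)) -> polar_part (\sum_(i <- s) f i).
Proof.
move=> h; rewrite big_seq; elim/big_ind: _ => //.
by move=> x y hx hy n n0 /=; rewrite hx ?hy ?addr0.
Qed.

Lemma regular_sum (I : Type) (s : seq I) (f : I -> laurent K) :
  (forall i, regular_part (f i)) -> regular_part (\sum_(i <- s) f i).
Proof.
move=> h; elim/big_ind: _ => //.
by move=> x y hx hy n n0 /=; rewrite hx ?hy ?addr0.
Qed.

(** [A_+] and [A_-] meet only in 0. *)
Lemma polar_regular_eq f g :
  polar_part f -> polar_part g -> regular_part (f - g) -> f = g.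
Proof.
move=> hf hg hr; apply: laurentP => n; have [n0|n0] := leP 0 n.
  by rewrite hf ?hg.
by apply/eqP; rewrite -subr_eq0; apply/eqP/hr.
Qed.

End Laurent.

(** * The contribution of a forest *)

Section Weight.
Variable k : comNzRingType.

Definition weight (F : forest) : laurent (coef_ring k) :=
  lmono (a_forest k F) (- (nroots F)%:Z).

Lemma a_forestE F : a_forest k F = \prod_(c <- polish F) a_ k c.
Proof. by apply: perm_big; rewrite perm_rev. Qed.

Lemma a_forest_cat F G : a_forest k (F ++ G) = a_forest k F * a_forest k G.
Proof. by rewrite !a_forestE /polish map_cat flatten_cat big_cat. Qed.

Lemma a_forest_tree F : a_forest k [:: Node F] = a_ k (size F) * a_forest k F.
Proof. by rewrite !a_forestE /polish /= cats0 big_cons. Qed.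

Lemma weight_nil : weight [::] = 1.
Proof. by rewrite /weight a_forestE big_nil oppr0. Qed.

Lemma weight_cat F G : weight (F ++ G) = weight F * weight G.
Proof. by rewrite /weight a_forest_cat lmonoM /nroots size_cat PoszD opprD. Qed.

Lemma weight_polar F : F != [::] -> polar_part (weight F).
Proof.
case: F => // t F _ n n0 /=; case: eqP => // e.
by rewrite e oppr_ge0 in n0.
Qed.

End Weight.

Lemma size_graft_from G n : (n <= size G)%N -> size (graft_from G n) = n.+1.
Proof. by move=> nG; rewrite /graft_from cats1 size_rcons size_takel. Qed.

Lemma lcoef_weight (k : comNzRingType) F n :
  lcoef (weight k F) n = if n == - (size F)%:Z then a_forest k F else 0.
Proof. by []. Qed.

Lemma a_forest_graft_from (k : comNzRingType) G n :
  a_forest k (graft_from G n) = a_ k (size G - n) * a_forest k G.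
Proof.
rewrite /graft_from a_forest_cat a_forest_tree size_drop mulrCA -a_forest_cat.
by rewrite cat_take_drop.
Qed.

(** The exponent is [r - (j + 1)], and [a_n] is the coefficient of [z^(n-1)]. *)
Lemma a_coef_shift (k : comNzRingType) (j r : nat) :
  lcoef (a_series k) (Negz j + r%:Z) = if (j <= r)%N then a_ k (r - j) else 0.
Proof.
rewrite /= /a_coef; case: leqP => h.
  by have -> : Negz j + r%:Z + 1 = Posz (r - j) by lia.
by have -> : Negz j + r%:Z + 1 = Negz (j - r).-1 by lia.
Qed.

(** The forests obtained from [G] by grafting its last trees on a new root
    account exactly for the polar part of [a(z)] times the contribution of
    [G]: in degree [- (j + 1)], both sides have the coefficient
    [a_(r-j) a_G], where [r = size G], if [j <= r], and 0 otherwise. *)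
Lemma mul_a_weight_regular (k : comNzRingType) (G : forest) :
  regular_part (a_series k * weight k G -
    \sum_(n <- iota 0 (size G).+1) weight k (graft_from G n)).
Proof.
rewrite -[iota _ _]/(index_iota 0 (size G).+1) big_mkord.
case=> // j _; rewrite lcoefB.
rewrite lcoef_mul_lmono lcoef_sum opprK.
have wE (i : 'I_(size G).+1) : lcoef (weight k (graft_from G i)) (Negz j) =
    if i == j :> nat then a_ k (size G - j) * a_forest k G else 0.
  have iG : (i <= size G)%N by rewrite -ltnS.
  rewrite lcoef_weight size_graft_from // NegzE eqr_opp eqz_nat eqSS eq_sym.
  by case: eqP => // <-; rewrite a_forest_graft_from.
rewrite (eq_bigr _ (fun i _ => wE i)) -big_mkcond a_coef_shift /nroots.
have [jG|Gj] := leqP j (size G).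
  by rewrite (big_pred1 (Ordinal (jG : j < (size G).+1)%N)) ?subrr.
rewrite big_pred0 ?mul0r ?subrr // => i; apply/negbTE/eqP => e.
by have := ltn_ord i; rewrite e ltnS leqNgt Gj.
Qed.

(** * The polar factor of the Birkhoff factorisation *)

Lemma Y_cat (k : comNzRingType) F G : Y (F ++ G) = Y F * Y G :> HNCK k.
Proof. by rewrite /Y malgM_def [RHS]fgmulUU mulr1. Qed.

(** The statement for forests is the one that can be proved by induction: the
    children of a root form a forest. *)
Lemma phi_plus_up_forest (k : comNzRingType)
    (phi phi_plus phi_minus : character k) :
  (forall F, phi (Y F) = a_series k ^+ fsize F) ->
  birkhoff phi phi_plus phi_minus ->
  forall F, phi_plus (Y F) = \sum_(G <- up_forest F) weight k G.
Proof.
move=> phiE [plusE plus_polar minus_reg]; elim/forest_ind => [|F G IHF IHG].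
  by rewrite big_seq1 weight_nil -(rmorph1 phi_plus).
have -> : phi_plus (Y (Node F :: G)) =
          phi_plus (Y [:: Node F]) * phi_plus (Y G).
  by rewrite -rmorphM -Y_cat.
rewrite IHG up_forest_cons big_allpairs_dep /=.
under [RHS]eq_bigr => A _ do
  (under eq_bigr => B _ do rewrite weight_cat; rewrite -mulr_sumr).
rewrite -mulr_suml; congr (_ * _).
(* both sides are polar; their difference is [phi_minus] plus regular terms *)
apply: polar_regular_eq; first exact: plus_polar.
  apply: polar_sum => A /up_treeP[l [r [-> _]]]; apply: weight_polar.
  by case: l.
rewrite plusE (convolution_tree _ phiE) -plusE IHF up_tree_Node.
rewrite big_allpairs_dep mulr_sumr -addrA -sumrB => n n0 /=.
rewrite minus_reg // add0r; apply: regular_sum n0 => A.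
exact: mul_a_weight_regular.
Qed.

Local Open Scope classical_set_scope.

Theorem theorem4p1 (R : realType) (phi phi_plus phi_minus : character R[i])
    (phiE : forall F : forest, phi (Y F) = a_series R[i] ^+ fsize F)
    (phi_birkhoff : birkhoff phi phi_plus phi_minus) (T : ptree) :
  phi_plus (Y [:: T]) =
    \sum_(F \in [set F : forest | tamari [:: T] F])
      lmono (a_forest R[i] F) (- (nroots F)%:Z).
Proof.
rewrite (phi_plus_up_forest phiE phi_birkhoff) fsbig_seq ?uniq_up_forest //.
by apply: eq_fsbigl; apply/seteqP; split=> F /up_forestP.
Qed.
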